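(* Let $Q$ be a fork with $n$ vertices and let $\boldsymbol{w}$ be a fork-preserving mutation sequence from $Q$. Then every $c$-vector $(x_1,\dots,x_n)$ of $Q$ obtained from $\boldsymbol{w}$ is a solution to a quadratic equation of the form $$\sum_{i=1}^n x_i^2+\sum_{1\le i<j\le n}\pm q_{ij}x_ix_j=1$$ (for some choice of the signs $\pm$), where $q_{ij}$ is the number of arrows between the vertices $i$ and $j$ in $Q$.
   Context: A quiver on the vertex set $\{1,\dots,n\}$ (no loops, no oriented 2-cycles) is identified with an $n\times n$ skew-symmetric integer matrix $B=[b_{ij}]$: if $b_{ij}>0$ there are $b_{ij}$ arrows from $i$ to $j$. Mutation: for an $n\times 2n$ integer matrix $M=[m_{ij}]$ and $k\in\{1,\dots,n\}$, the mutation of $M$ at $k$ is the matrix with entries $-m_{ij}$ if $i=k$ or $j=k$, and $m_{ij}+\mathrm{sgn}(m_{ik})\max(m_{ik}m_{kj},0)$ otherwise. A mutation sequence $\boldsymbol{w}=[i_1,\dots,i_\ell]$ (possibly empty) means mutating at $i_1$, then $i_2$, etc.; it is reduced if $i_j\ne i_{j+1}$ for all $j$. Starting from $[B\mid I]$, the result after $\boldsymbol{w}$ is written $[B^{\boldsymbol{w}}\mid C^{\boldsymbol{w}}]$; the rows $c_1^{\boldsymbol{w}},\dots,c_n^{\boldsymbol{w}}$ of $C^{\boldsymbol{w}}$ are the $c$-vectors of $B$ obtained from $\boldsymbol{w}$. A quiver is abundant if there are at least two arrows between every pair of distinct vertices. A fork is an abundant, non-acyclic quiver $F=[f_{ij}]$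 with a vertex $r$ (the point of return, which is unique) such that, with $F^-(r)$ the set of vertices having arrows to $r$ and $F^+(r)$ the set of vertices receiving arrows from $r$: for all $i\in F^-(r)$, $j\in F^+(r)$ one has $f_{ji}>f_{ir}$ and $f_{ji}>f_{rj}$; and the full subquivers on $F^-(r)$ and on $F^+(r)$ are acyclic. A fork-preserving mutation sequence from a fork with point of return $r$ is a reduced mutation sequence whose first mutation (if any) is not at $r$. *)

(* Defs.v *)
From mathcomp Require Import all_boot all_order all_algebra.
Set Implicit Arguments.
Unset Strict Implicit.
Unset Printing Implicit Defensive.
Import Order.TTheory GRing.Theory Num.Theory.
Local Open Scope ring_scope.

(* A quiver without loops or oriented 2-cycles on the vertex set 'I_n is
   encoded by a skew-symmetric integer matrix: 0 < B i j means that there are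
   B i j arrows from i to j (and none from j to i). *)
Definition is_quiver n (B : 'M[int]_n) : Prop := B^T = - B.

Definition arrow n (B : 'M[int]_n) : rel 'I_n := fun i j => 0 < B i j.

Definition num_arrows n (B : 'M[int]_n) (i j : 'I_n) : int := `|B i j|.

(* The full subquiver on A has no oriented cycle; the path.v predicate
   [cycle] holds of the empty sequence, which has to be excluded. *)
Definition acyclic_on n (B : 'M[int]_n) (A : {set 'I_n}) : Prop :=
  forall c : seq 'I_n,
    c != [::] -> {subset c <= A} -> ~~ cycle (arrow B) c.

Definition acyclic n (B : 'M[int]_n) : Prop := acyclic_on B [set: 'I_n].

Definition abundant n (B : 'M[int]_n) : Prop :=
  forall i j : 'I_n, i != j -> 2 <= num_arrows B i j.

Definition in_nbrs n (B : 'M[int]_n) (r : 'I_n) : {set 'I_n} :=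
  [set i | arrow B i r].

Definition out_nbrs n (B : 'M[int]_n) (r : 'I_n) : {set 'I_n} :=
  [set j | arrow B r j].

(* B is a fork with point of return r. *)
Definition is_fork n (B : 'M[int]_n) (r : 'I_n) : Prop :=
  [/\ is_quiver B, abundant B & ~ acyclic B] /\
  [/\ forall i j : 'I_n, i \in in_nbrs B r -> j \in out_nbrs B r ->
        B i r < B j i /\ B r j < B j i,
      acyclic_on B (in_nbrs B r)
    & acyclic_on B (out_nbrs B r)].

(* The left n columns are indexed by lshift n k, so that [lshift n k] below is
   the k-th column of the full n x 2n matrix. *)
Definition mutation n (k : 'I_n) (M : 'M[int]_(n, n + n)) :
    'M[int]_(n, n + n) :=
  \matrix_(i, j)
    if (i == k) || (j == lshift n k) then - M i j
    else M i j
         + Num.sg (M i (lshift n k)) * Num.max (M i (lshift n k) * M k j) 0.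

Definition mutate_seq n (w : seq 'I_n) (M : 'M[int]_(n, n + n)) :
    'M[int]_(n, n + n) :=
  foldl (fun M' k => mutation k M') M w.

Definition c_matrix n (B : 'M[int]_n) (w : seq 'I_n) : 'M[int]_n :=
  rsubmx (mutate_seq w (row_mx B 1%:M)).

Definition c_vector n (B : 'M[int]_n) (w : seq 'I_n) (k : 'I_n) : 'rV[int]_n :=
  row k (c_matrix B w).

Definition reduced n (w : seq 'I_n) : bool := sorted (fun i j => i != j) w.

Definition fork_preserving n (r : 'I_n) (w : seq 'I_n) : bool :=
  reduced w && (ohead w != Some r).

(* Main.v *)
(** Fix a symmetric matrix [A] with diagonal 2 and [|A i j| = q_ij].  If the
    Gram matrix [C A C^T] of the c-vectors always has diagonal 2, then each
    c-vector [x] satisfies [x A x^T = 2], which is the asserted equation.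

    When mutating at [k] replaces [c_i] by [c_i + |b_ik| c_k], the norm of [c_i]
    is preserved exactly if [(c_i, c_k) = - |b_ik|], so that the replacement is
    the reflection of [c_i] in [c_k].  To guarantee this, carry along the
    sequence the signs [s_i] of the c-vectors and the Gram matrix: off the
    point of return [r], [(c_i, c_j) = - s_i s_j |b_ij|] and no arrow goes from
    a negative to a positive vertex, while [(c_r, c_j) = - s_j b_rj].  Sign
    coherence comes out of the same induction: after mutating at [r], every
    c-vector that was moved dominates [c_r] entrywise.

    At the start all signs are +, and the sign of the entries [A r j] has to be
    chosen according to whether the first mutation is at an in- or an
    out-neighbour of [r]. *)
Require Import Defs.
From mathcomp Require Import all_boot all_order all_algebra.
From mathcomp Require Import zify ring.
Set Implicit Arguments.
Unset Strict Implicit.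
Unset Printing Implicit Defensive.
Import Order.TTheory GRing.Theory Num.Theory.
Local Open Scope ring_scope.

(** * Mutation on the two blocks [B] and [C] *)

Definition mutB n (k : 'I_n) (B : 'M[int]_n) : 'M[int]_n :=
  \matrix_(i, j) if (i == k) || (j == k) then - B i j
    else B i j + Num.sg (B i k) * Num.max (B i k * B k j) 0.

Definition mutC n (k : 'I_n) (B C : 'M[int]_n) : 'M[int]_n :=
  \matrix_(i, j) if i == k then - C i j
    else C i j + Num.sg (B i k) * Num.max (B i k * C k j) 0.

Lemma mutation_row_mx n (k : 'I_n) (B C : 'M[int]_n) :
  mutation k (row_mx B C) = row_mx (mutB k B) (mutC k B C).
Proof.
apply/matrixP => i j; rewrite /mutation mxE -(splitK j).
case: (split j) => j' /=.
  by rewrite !row_mxEl mxE (inj_eq (@lshift_inj _ _)).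
by rewrite !row_mxEl !row_mxEr mxE eq_rlshift orbF.
Qed.

Lemma mutBN n (k : 'I_n) (B : 'M[int]_n) : mutB k (- B) = - mutB k B.
Proof.
apply/matrixP => i j; rewrite !mxE; case: ifP => // _.
by rewrite sgrN mulrNN mulNr opprD.
Qed.

Lemma mutCN n (k : 'I_n) (B C : 'M[int]_n) : mutC k (- B) (- C) = - mutC k B C.
Proof.
apply/matrixP => i j; rewrite !mxE; case: ifP => // _.
by rewrite sgrN mulrNN mulNr opprD.
Qed.

(** * Gram matrices of rows *)

Definition gram n (A C : 'M[int]_n) : 'M[int]_n := C *m A *m C^T.

Lemma gramE n (A C : 'M[int]_n) i j :
  gram A C i j = \sum_k \sum_l C i k * A k l * C j l.
Proof.
rewrite /gram mxE exchange_big /=; apply: eq_bigr => l _.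
by rewrite !mxE mulr_suml.
Qed.

Lemma gram_sym n (A C : 'M[int]_n) i j : A^T = A -> gram A C i j = gram A C j i.
Proof.
move=> As; rewrite -[in RHS](trmxK (gram A C)) [RHS]mxE.
by rewrite /gram !trmx_mul trmxK As mulmxA.
Qed.

Lemma gramN n (A C : 'M[int]_n) : gram A (- C) = gram A C.
Proof. by rewrite /gram raddfN /= mulNmx mulmxN mulNmx opprK. Qed.

Lemma gram1 n (A : 'M[int]_n) : gram A 1%:M = A.
Proof. by rewrite /gram trmx1 mulmx1 mul1mx. Qed.

Lemma gram_rows n (A C D : 'M[int]_n) (k : 'I_n) (d m : 'I_n -> int) :
    (forall i j, D i j = d i * C i j + m i * C k j) ->
  forall i j, gram A D i j =
    d i * d j * gram A C i j + d i * m j * gram A C i k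
    + m i * d j * gram A C k j + m i * m j * gram A C k k.
Proof.
move=> DE i j; rewrite !gramE !mulr_sumr -!big_split /=.
apply: eq_bigr => u _; rewrite !mulr_sumr -!big_split /=.
by apply: eq_bigr => v _; rewrite !DE; ring.
Qed.

(** * The invariant and its symmetry under negation *)

(* [s i] is the sign of the [i]-th c-vector.  Any cyclic triangle of a fork
   passes through its point of return, whence [fs_trans]. *)
Record fork_state n (B C G : 'M[int]_n) (s : 'I_n -> int) (r : 'I_n) : Prop := {
  fs_skew : forall i j, B j i = - B i j;
  fs_abundant : forall i j, i != j -> 2 <= `|B i j|;
  fs_trans : forall i j l, i != r -> j != r -> l != r ->
    0 < B i j -> 0 < B j l -> 0 < B i l;
  fs_return : forall i j, 0 < B i r -> 0 < B r j ->
    B i r < B j i /\ B r j < B j i;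
  fs_sign : forall i, s i = 1 \/ s i = -1;
  fs_coherent : forall i j, 0 <= s i * C i j;
  fs_order : forall i j, i != r -> j != r -> 0 < B i j -> s j <= s i;
  fs_norm : forall i, G i i = 2;
  fs_gram : forall i j, i != r -> j != r -> i != j ->
    G i j = - (s i * s j * `|B i j|) }.

(* What mutation at [k] needs to know about the row [r] of the point of return:
   [s k * B r k > 0] says that this mutation moves [c_r].  The case distinction
   on the Gram row matters only before the first mutation; afterwards the
   [rd_moved_gram] formula always holds, and in the fixed case it agrees with
   [rd_fixed_gram] because then [s r = - s k]. *)
Record ready n (B C G : 'M[int]_n) (s : 'I_n -> int) (r k : 'I_n) : Prop := {
  rd_moved_gram : 0 < s k * B r k -> forall j, j != r ->
    G r j = - (s j * B r j);
  rd_moved_growth : 0 < s k * B r k -> forall j,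
    0 <= s k * C r j + (`|B r k| - 1) * (s k * C k j);
  rd_fixed_gram : s k * B r k < 0 -> forall j, j != r ->
    G r j = s k * s r * s j * B r j;
  rd_fixed_order : s k * B r k < 0 -> forall i, i != r ->
    0 < s k * B k i -> 0 < s k * B i r -> s k * s r <= s k * s i }.

Lemma fork_stateN n (B C G : 'M[int]_n) s r :
  fork_state B C G s r -> fork_state (- B) (- C) G (fun i => - s i) r.
Proof.
case=> sk ab tr re si co or no gr; split.
- by move=> i j; rewrite !mxE sk.
- by move=> i j ij; rewrite mxE normrN ab.
- move=> i j l ir jr lr; rewrite !mxE -!sk => h1 h2.
  exact: (tr l j i).
- move=> i j; rewrite !mxE -!sk => h1 h2.
  by have [] := re _ _ h2 h1.
- by move=> i; case: (si i) => ->; [right|left].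
- by move=> i j; rewrite mxE mulrNN.
- by move=> i j ir jr; rewrite mxE -sk lerN2; apply: or.
- by [].
- by move=> i j ir jr ij; rewrite mxE normrN mulrNN gr.
Qed.

Lemma readyN n (B C G : 'M[int]_n) s r k :
  ready B C G s r k -> ready (- B) (- C) G (fun i => - s i) r k.
Proof.
case=> mg mr fg fo; split; rewrite !mxE mulrNN.
- by move=> h j jr; rewrite mxE mulrNN mg.
- by move=> h j; rewrite !mxE normrN !mulrNN mr.
- by move=> h j jr; rewrite mxE fg //; ring.
- by move=> h i ir; rewrite !mxE !mulrNN; apply: fo.
Qed.

(** * One mutation off the point of return *)

(* One mutation at a positive vertex [k]; the negative case reduces to this one
   because mutation commutes with negating [B | C].  A vertex [i] is moved if
   [0 < B i k] and fixed if [0 < B k i]. *)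
Section Step.
Variables (n : nat) (A B C : 'M[int]_n) (s : 'I_n -> int) (r k : 'I_n).
Hypotheses (As : A^T = A) (kr : k != r).
Hypothesis st : fork_state B C (gram A C) s r.
Hypothesis rd : ready B C (gram A C) s r k.
Hypothesis sk1 : s k = 1.

(** Moved vertices other than [r] are already positive by [fs_order]; only a moved [r] can change
    its sign. *)
Let s' i : int := if i == k then - 1 else if 0 < B i k then 1 else s i.

Let skew i j : B j i = - B i j := fs_skew st i j.

Let orient i j : i != j -> 2 <= B i j \/ 2 <= B j i.
Proof. by move=> /(fs_abundant st); rewrite (skew i j); lia. Qed.

Let Bii i : B i i = 0.
Proof. by have := skew i i; lia. Qed.

Let moved_neq i : 0 < B i k -> i != k.
Proof. by apply: contraTneq => ->; rewrite Bii. Qed.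

Let fixed_neq i : 0 < B k i -> i != k.
Proof. by apply: contraTneq => ->; rewrite Bii. Qed.

Lemma mutB_skew i j : mutB k B j i = - mutB k B i j.
Proof.
rewrite !mxE (skew i j) (skew i k) (skew k j) orbC.
case: ifP => // _.
rewrite sgrN mulrNN [B k j * _]mulrC.
case: (ltrgtP (B i k) 0) => [h|h|->]; case: (ltrgtP (B k j) 0) => [h'|h'|->];
  rewrite ?(ltr0_sg h) ?(gtr0_sg h) ?(ltr0_sg h') ?(gtr0_sg h') ?sgr0;
  nia.
Qed.

Lemma mutB_row i : mutB k B k i = - B k i.
Proof. by rewrite mxE eqxx. Qed.

Lemma mutB_col i : mutB k B i k = - B i k.
Proof. by rewrite mxE eqxx orbT. Qed.

Lemma mutB_moved i j : 0 < B i k -> 0 < B j k -> mutB k B i j = B i j.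
Proof.
move=> hi hj; rewrite mxE (negPf (moved_neq hi)) (negPf (moved_neq hj)) /=.
by rewrite max_r ?mulr0 ?addr0 //; have := skew j k; nia.
Qed.

Lemma mutB_fixed i j : 0 < B k i -> 0 < B k j -> mutB k B i j = B i j.
Proof.
move=> hi hj; rewrite mxE (negPf (fixed_neq hi)) (negPf (fixed_neq hj)) /=.
by rewrite max_r ?mulr0 ?addr0 //; have := skew i k; nia.
Qed.

Lemma mutB_path i j : 0 < B i k -> 0 < B k j ->
  mutB k B i j = B i j + B i k * B k j.
Proof.
move=> hi hj; rewrite mxE (negPf (moved_neq hi)) (negPf (fixed_neq hj)) /=.
by rewrite gtr0_sg // mul1r max_l // mulr_ge0 // ltW.
Qed.

(* Mutating a fork off its point of return yields a fork with point of return
   [k]: this is the inequality defining the latter. *)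
Lemma mutB_path_gt i j : 0 < B i k -> 0 < B k j ->
  B i k < mutB k B i j /\ B k j < mutB k B i j.
Proof.
move=> hi hj; rewrite mutB_path //.
have hi2 : 2 <= B i k by have := orient (moved_neq hi); rewrite (skew i k); lia.
have hj2 : 2 <= B k j by have := orient (fixed_neq hj); rewrite (skew k j); lia.
have ij : i != j by apply: contraTneq hi => ->; rewrite (skew k j); lia.
have [hij|hji] := orient ij; first by nia.
(* If [j] has arrows to [i], the triangle on [i], [k], [j] is cyclic, so [i] or [j] is [r]. The side
   opposite [r] is [B k j] or [B i k] and exceeds [B j i], so the product [B i k * B k j] outweighs
   the loss. *)
have [ir|ir] := eqVneq i r.
  have [] := fs_return st (_ : 0 < B j r) (_ : 0 < B r k); rewrite -?ir //.
    by lia.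
  by have := skew i j; nia.
have [jr|jr] := eqVneq j r.
  have [] := fs_return st (_ : 0 < B k r) (_ : 0 < B r i); rewrite -?jr //.
    by lia.
  by have := skew i j; nia.
by have := fs_trans st ir kr jr hi hj; have := skew i j; lia.
Qed.

Lemma mutC_return j : mutC k B C k j = - C k j.
Proof. by rewrite mxE eqxx. Qed.

Let Ck_ge0 j : 0 <= C k j.
Proof. by have := fs_coherent st k j; rewrite sk1 mul1r. Qed.

Lemma mutC_moved i j : 0 < B i k -> mutC k B C i j = C i j + B i k * C k j.
Proof.
move=> hi; rewrite mxE (negPf (moved_neq hi)) gtr0_sg // mul1r max_l //.
by rewrite mulr_ge0 // ltW.
Qed.

Lemma mutC_fixed i j : 0 < B k i -> mutC k B C i j = C i j.
Proof.
move=> hi; rewrite mxE (negPf (fixed_neq hi)) max_r ?mulr0 ?addr0 //.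
by have := Ck_ge0 j; have := skew i k; nia.
Qed.

Let C' := mutC k B C.
Let G := gram A C.
Let G' := gram A C'.
Let Gs i j : G i j = G j i := gram_sym C i j As.

Lemma mutC_rowE i j :
  C' i j = (if i == k then -1 else 1) * C i j
           + (if 0 < B i k then B i k else 0) * C k j.
Proof.
have [->|ik] := eqVneq i k; first by rewrite Bii ltxx mutC_return; ring.
have [h|h] := orient ik.
  have hi : 0 < B i k by lia.
  by rewrite hi [C' i j]mutC_moved // mul1r.
have hi : (0 < B i k) = false by have := skew i k; lia.
by rewrite hi [C' i j]mutC_fixed ?mul1r ?mul0r ?addr0 //; lia.
Qed.

Let G'E i j :
  G' i j =
    (if i == k then -1 else 1) * (if j == k then -1 else 1) * G i j
    + (if i == k then -1 else 1) * (if 0 < B j k then B j k else 0) * G i k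
    + (if 0 < B i k then B i k else 0) * (if j == k then -1 else 1) * G k j
    + (if 0 < B i k then B i k else 0) * (if 0 < B j k then B j k else 0) * 2.
Proof.
rewrite /G' (gram_rows A (d := fun i => if i == k then -1 else 1)
  (m := fun i => if 0 < B i k then B i k else 0) mutC_rowE).
by rewrite (fs_norm st).
Qed.

Let moved_sign i : i != r -> 0 < B i k -> s i = 1.
Proof.
move=> ir hi; have := fs_order st ir kr hi; rewrite sk1.
by have := fs_sign st i; lia.
Qed.

Let moved_gram i : 0 < B i k -> G k i = - B i k.
Proof.
move=> hi; rewrite Gs; have [ir|ir] := eqVneq i r.
  by rewrite ir (rd_moved_gram rd) ?sk1 ?mul1r // -ir.
rewrite (fs_gram st) ?moved_neq // sk1 moved_sign //.
by rewrite gtr0_norm //; ring.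
Qed.

Let fixed_gram j : j != r -> 0 < B k j -> G k j = - (s j * B k j).
Proof.
move=> jr hj; rewrite (fs_gram st) //; last by rewrite eq_sym fixed_neq.
by rewrite sk1 gtr0_norm //; ring.
Qed.

Let fixed_gram_return : 0 < B k r -> forall j, j != r ->
  G j r = s r * s j * B r j.
Proof.
move=> h j jr; rewrite Gs (rd_fixed_gram rd) ?sk1 ?mul1r //.
by rewrite (skew k r); lia.
Qed.


Let kside i : i != k -> 0 < B i k \/ 0 < B k i.
Proof. by move=> /orient; lia. Qed.

Let kasym i : 0 < B k i -> (0 < B i k) = false.
Proof. by rewrite (skew i k); lia. Qed.

Let s'_k : s' k = -1.
Proof. by rewrite /s' eqxx. Qed.

Let s'_moved i : 0 < B i k -> s' i = 1.
Proof. by move=> hi; rewrite /s' hi (negPf (moved_neq hi)). Qed.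

Let s'_fixed i : 0 < B k i -> s' i = s i.
Proof. by move=> hi; rewrite /s' kasym // (negPf (fixed_neq hi)). Qed.

(** Both rows undergo the same reflection in the [k]-th c-vector. *)
Let G'_moved i j : 0 < B i k -> 0 < B j k -> G' i j = G i j.
Proof.
move=> hi hj; rewrite G'E hi hj (negPf (moved_neq hi)) (negPf (moved_neq hj)).
by rewrite [G i k]Gs !moved_gram //; ring.
Qed.

Let G'_fixed i j : 0 < B k i -> 0 < B k j -> G' i j = G i j.
Proof.
move=> hi hj; rewrite G'E !kasym //.
by rewrite (negPf (fixed_neq hi)) (negPf (fixed_neq hj)); ring.
Qed.

Let G'_path i j : 0 < B i k -> 0 < B k j -> G' i j = G i j + B i k * G k j.
Proof.
move=> hi hj; rewrite G'E hi (kasym hj) (negPf (moved_neq hi)).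
by rewrite (negPf (fixed_neq hj)); ring.
Qed.

Let G'k_moved i : 0 < B i k -> G' k i = - B i k.
Proof.
move=> hi; rewrite G'E hi eqxx (negPf (moved_neq hi)) Bii ltxx moved_gram //.
by rewrite (fs_norm st); ring.
Qed.

Let G'k_fixed i : 0 < B k i -> G' k i = - G k i.
Proof.
move=> hi; rewrite G'E (kasym hi) eqxx (negPf (fixed_neq hi)) Bii ltxx; ring.
Qed.

Let G'sym i j : G' i j = G' j i := gram_sym C' i j As.

(** The case [i = r] fits the general formula because the arrows run from [r] to [j]: the other
    direction would force arrows from [k] to [j] by [fs_return]. *)
Let moved_pair i j : 0 < B i k -> 0 < B j k -> i != j -> j != r ->
  G i j = - `|B i j|.
Proof.
move=> hi hj ij jr; have [ir|ir] := eqVneq i r; last first.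
  by rewrite (fs_gram st) // !moved_sign // !mul1r.
have rk : 0 < B r k by rewrite -ir.
rewrite ir (rd_moved_gram rd) ?sk1 ?mul1r // moved_sign //.
have rj : r != j by rewrite -ir.
have [h|h] := orient rj; first by lia.
have [] := fs_return st (_ : 0 < B j r) rk; first by lia.
by have := skew k j; lia.
Qed.

Let fixed_pair i j : 0 < B k i -> 0 < B k j -> i != j -> j != r ->
  G i j = - (s i * s j * `|B i j|).
Proof.
move=> hi hj ij jr; have [ir|ir] := eqVneq i r; last by rewrite (fs_gram st).
have kr0 : 0 < B k r by rewrite -ir.
rewrite ir Gs fixed_gram_return //.
have rj : r != j by rewrite -ir.
have [h|h] := orient rj; last by have := skew r j; nia.
have [] := fs_return st kr0 (_ : 0 < B r j); first by lia.
by have := skew k j; lia.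
Qed.

(** Mutation acts on [G i j] and [B i j] by the same recipe, so [G i j = - (s j * B i j)] without
    absolute value suffices. Off [r] this holds since [fs_trans] makes [B i j] positive; at [r] the
    formulas of [ready] are signed already. *)
Let path_pair i j : 0 < B i k -> 0 < B k j ->
  G i j + B i k * G k j = - (s j * `|mutB k B i j|).
Proof.
move=> hi hj; rewrite gtr0_norm; last by have := mutB_path_gt hi hj; lia.
rewrite mutB_path //; have [jr|jr] := eqVneq j r.
  have kr0 : 0 < B k r by rewrite -jr.
  have ir : i != r by apply: contraTneq hi => ->; have := skew r k; lia.
  rewrite jr !fixed_gram_return // [s i]moved_sign // sk1 (skew i r) (skew k r).
  ring.
rewrite fixed_gram //; have [ir|ir] := eqVneq i r.
  have hr : 0 < s k * B r k by rewrite sk1 mul1r -ir.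
  by rewrite ir (rd_moved_gram rd hr) //; ring.
have ij : i != j by apply: contraTneq hi => ->; rewrite (skew k j); lia.
have hij := fs_trans st ir kr jr hi hj.
by rewrite (fs_gram st) // moved_sign // gtr0_norm //; ring.
Qed.

(** Off [r] a nonnegative row gains at least twice row [k]. Row [r] may be negative, which is what
    [rd_moved_growth] compensates. *)
Let moved_growth i j : 0 < B i k -> C k j <= C' i j.
Proof.
move=> hi; rewrite [C' i j]mutC_moved //.
have hi2 : 2 <= B i k by have := orient (moved_neq hi); rewrite (skew i k); lia.
have [ir|ir] := eqVneq i r.
  have hr : 0 < s k * B r k by rewrite sk1 mul1r -ir.
  have := rd_moved_growth rd hr j; rewrite sk1 !mul1r -ir.
  by have := Ck_ge0 j; nia.
by have := fs_coherent st i j; rewrite moved_sign //; have := Ck_ge0 j; nia.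
Qed.

Let return_source i : 0 < B i k -> 0 < B r k -> ~~ (0 < B i r).
Proof.
move=> hi hr; apply/negP => hir; have [] := fs_return st hir hr.
by have := skew i k; lia.
Qed.

Let return_sink i : 0 < B k i -> 0 < B k r -> ~~ (0 < B r i).
Proof.
move=> hi hr; apply/negP => hri; have [] := fs_return st hr hri.
by have := skew i k; lia.
Qed.

(** Arrows between the two sides now run from moved to fixed, so only triples within one side need
    an argument. There [r] is a source among moved or a sink among fixed vertices, and the old
    transitivity extends to it. *)
Let mutB_trans i j l : i != k -> j != k -> l != k ->
  0 < mutB k B i j -> 0 < mutB k B j l -> 0 < mutB k B i l.
Proof.
have back u v : 0 < B k u -> 0 < B v k -> 0 < mutB k B u v -> False.
  by move=> hu hv; have := mutB_path_gt hv hu; rewrite (mutB_skew v u); lia.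
move=> ik jk lk.
have [hi|hi] := kside ik; have [hl|hl] := kside lk; have [hj|hj] := kside jk.
- rewrite !mutB_moved // => hij hjl.
  have il : i != l.
    by apply: contraTneq hjl => <-; have := skew i j; lia.
  have [jr|jr] := eqVneq j r.
    by have := return_source hi; rewrite -jr hij => /(_ hj).
  have [lr|lr] := eqVneq l r.
    by have := return_source hj; rewrite -lr hjl => /(_ hl).
  have [ir|ir] := eqVneq i r; last exact: (fs_trans st ir jr lr hij hjl).
  have := return_source hl; rewrite -ir => /(_ hi).
  by have := orient il; lia.
- by move=> _ /back; case.
- by move=> *; have := mutB_path_gt hi hl; lia.
- by move=> *; have := mutB_path_gt hi hl; lia.
- by move=> /back; case.
- by move=> _ /back; case.
- by move=> /back; case.
- rewrite !mutB_fixed // => hij hjl.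
  have il : i != l.
    by apply: contraTneq hjl => <-; have := skew i j; lia.
  have [jr|jr] := eqVneq j r.
    by have := return_sink hl; rewrite -jr hjl => /(_ hj).
  have [ir|ir] := eqVneq i r.
    by have := return_sink hj; rewrite -ir hij => /(_ hi).
  have [lr|lr] := eqVneq l r; last exact: (fs_trans st ir jr lr hij hjl).
  have := return_sink hi; rewrite -lr => /(_ hl).
  by have := orient il; lia.
Qed.

Lemma fork_state_step : fork_state (mutB k B) C' G' s' k.
Proof.
have abund i j : i != k -> j != k -> i != j -> 2 <= `|mutB k B i j|.
  move=> ik jk ij; have := orient ij; have := skew i j.
  have [hi|hi] := kside ik; have [hj|hj] := kside jk.
  - by rewrite mutB_moved //; lia.
  - by have := mutB_path_gt hi hj; lia.
  - by have := mutB_path_gt hj hi; rewrite (mutB_skew j i); lia.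
  - by rewrite mutB_fixed //; lia.
split.
- exact: mutB_skew.
- move=> i j ij; have [ik|ik] := eqVneq i k.
    by have := orient ij; have := skew i j; rewrite ik mutB_row; lia.
  have [jk|jk] := eqVneq j k; last exact: abund.
  by rewrite jk mutB_col; have := orient ij; have := skew i j; rewrite jk; lia.
- exact: mutB_trans.
- move=> i j; rewrite mutB_col mutB_row => hi hj.
  have hi' : 0 < B k i by have := skew i k; lia.
  have hj' : 0 < B j k by have := skew k j; lia.
  have := mutB_path_gt hj' hi'; have := skew i k; have := skew j k; lia.
- move=> i; rewrite /s'; case: ifP => _; first by right.
  by case: ifP => _; [left|exact: (fs_sign st i)].
- move=> i j; have [->|ik] := eqVneq i k.
    by rewrite s'_k [C' k j]mutC_return; have := Ck_ge0 j; lia.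
  have [hi|hi] := kside ik; last first.
    by rewrite s'_fixed // [C' i j]mutC_fixed //; exact: (fs_coherent st i j).
  rewrite s'_moved // mul1r.
  exact: le_trans (Ck_ge0 j) (moved_growth j hi).
- move=> i j ik jk; have [hi|hi] := kside ik; have [hj|hj] := kside jk.
  + by rewrite !s'_moved.
  + by rewrite (s'_moved hi) (s'_fixed hj); have := fs_sign st j; lia.
  + by have := mutB_path_gt hj hi; rewrite (mutB_skew j i); lia.
  (* A fixed [r] has no arrows to fixed vertices, which excludes [i = r]; the case [j = r] is what
     [rd_fixed_order] provides for. *)
  + rewrite mutB_fixed // !s'_fixed // => hij.
    have [ir|ir] := eqVneq i r.
      have kr0 : 0 < B k r by rewrite -ir.
      have [] := fs_return st kr0 (_ : 0 < B r j); first by rewrite -ir.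
      by have := skew k j; lia.
    have [jr|jr] := eqVneq j r; last exact: (fs_order st ir jr hij).
    have hr : s k * B r k < 0.
      by rewrite sk1 mul1r -jr; have := skew k j; lia.
    by have := rd_fixed_order rd hr ir; rewrite sk1 !mul1r -jr; apply.
- move=> i; rewrite G'E !(fs_norm st); have [->|ik] := eqVneq i k.
    by rewrite Bii ltxx; ring.
  have [hi|hi] := kside ik; last by rewrite kasym //; ring.
  by rewrite hi [G i k]Gs moved_gram //; ring.
- move=> i j ik jk ij.
  have [hi|hi] := kside ik; have [hj|hj] := kside jk.
  + rewrite G'_moved // mutB_moved // !s'_moved // !mul1r.
    have [jr|jr] := eqVneq j r; last exact: moved_pair.
    rewrite Gs moved_pair // -?jr // 1?eq_sym //.
    by rewrite (skew i j) normrN.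
  + by rewrite G'_path // path_pair // (s'_moved hi) (s'_fixed hj) mul1r.
  + rewrite G'sym G'_path // path_pair // (s'_moved hj) (s'_fixed hi) mulr1.
    by rewrite (mutB_skew i j) normrN.
  + rewrite G'_fixed // mutB_fixed // !s'_fixed //.
    have [jr|jr] := eqVneq j r; last exact: fixed_pair.
    rewrite Gs fixed_pair // -?jr // 1?eq_sym //.
    by rewrite (skew i j) normrN [s j * _]mulrC.
Qed.

Let G'_return j : j != k -> G' k j = - (s' j * mutB k B k j).
Proof.
move=> jk; rewrite mutB_row; have [hj|hj] := kside jk.
  by rewrite G'k_moved // s'_moved // (skew j k); ring.
rewrite G'k_fixed // s'_fixed //; have [jr|jr] := eqVneq j r.
  rewrite jr fixed_gram_return // -?jr // sk1 (skew k j); ring.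
by rewrite fixed_gram //; ring.
Qed.

Lemma ready_step l : l != k -> ready (mutB k B) C' G' s' k l.
Proof.
move=> lk; split.
- by move=> _; apply: G'_return.
- move=> + j; rewrite mutB_row [C' k j]mutC_return; have := Ck_ge0 j.
  have [hl|hl] := kside lk.
    rewrite s'_moved //; have := moved_growth j hl.
    by have := orient lk; have := skew l k; nia.
  (* For fixed [l] the hypothesis forces [s l = -1], and both summands are nonnegative. *)
  rewrite s'_fixed // [C' l j]mutC_fixed //; have := fs_coherent st l j.
  by have := orient lk; have := skew l k; case: (fs_sign st l) => ->; nia.
- move=> + j jk; rewrite G'_return // !mutB_row s'_k.
  have [hl|hl] := kside lk.
    by rewrite s'_moved //; have := skew l k; lia.
  by rewrite s'_fixed //; case: (fs_sign st l) => -> ?; [ring|lia].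
- move=> + i ik; rewrite !mutB_row s'_k.
  have [hl|hl] := kside lk.
    by rewrite s'_moved //; have := skew l k; lia.
  (* Only [s l = 1] survives, and the claim becomes [-1 <= s' i]. *)
  rewrite s'_fixed //; case: (fs_sign st l) => ->; last lia.
  by move=> _ _ _; rewrite /s'; case: ifP => // _; case: ifP => // _;
    case: (fs_sign st i) => ->.
Qed.

End Step.

(** * Mutation sequences *)

Lemma fork_state_mutation n (A B C : 'M[int]_n) s r k :
    A^T = A -> k != r ->
    fork_state B C (gram A C) s r -> ready B C (gram A C) s r k ->
  exists s', let B' := mutB k B in let C' := mutC k B C in
    fork_state B' C' (gram A C') s' k /\
    forall l, l != k -> ready B' C' (gram A C') s' k l.
Proof.
move=> As kr st rd; case: (fs_sign st k) => sk.
  by eexists; split; [apply: fork_state_step rd sk|apply: ready_step rd sk].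
have st' := fork_stateN st; have rd' := readyN rd.
have sk' : - s k = 1 by rewrite sk opprK.
rewrite -[gram A C]gramN in st' rd'.
exists (fun i => - (if i == k then -1 else if 0 < (- B) i k then 1 else - s i)).
split.
  have := fork_stateN (fork_state_step As kr st' rd' sk').
  by rewrite mutBN mutCN !opprK gramN.
move=> l lk; have := readyN (ready_step As kr st' rd' sk' lk).
by rewrite mutBN mutCN !opprK gramN.
Qed.

(** After mutating at [k] the point of return is [k], and reducedness keeps the next mutation off
    it. Each step supplies [ready] for the next one, so it is assumed for the first only. *)
Lemma gram_norm_mutate_seq n (A B C : 'M[int]_n) s r w i :
    A^T = A -> reduced w -> ohead w != Some r ->
    fork_state B C (gram A C) s r ->
    (forall k, ohead w = Some k -> ready B C (gram A C) s r k) ->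
  gram A (rsubmx (mutate_seq w (row_mx B C))) i i = 2.
Proof.
move=> As; elim: w => [|k w IHw] in B C s r *.
  by move=> _ _ st _; rewrite row_mxKr (fs_norm st).
move=> red kr st rd; have {}kr : k != r by apply: contraNneq kr => ->.
have [s' [st' rd']] := fork_state_mutation As kr st (rd k erefl).
rewrite /mutate_seq /= mutation_row_mx.
have wk : ohead w != Some k.
  case: w red {IHw rd} => //= l w /andP[kl _].
  by apply: contraNneq kl => -[->].
apply: (IHw _ _ s' k _ wk st').
  by case: w red {rd wk IHw} => //= l w /andP[].
by move=> l wl; apply: rd'; apply: contraNneq wk => <-; rewrite wl.
Qed.

(** * The symmetric matrix and the initial state *)

(** For [e = 1] or [e = -1], a quasi-Cartan companion of [Q]; [e] leaves open the sign of the row of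
    [r], on which [fs_gram] is silent. *)
Definition companion n (Q : 'M[int]_n) (r : 'I_n) (e : int) : 'M[int]_n :=
  \matrix_(i, j) if i == j then 2 else if i == r then e * Q r j
    else if j == r then e * Q r i else - `|Q i j|.

Lemma companion_norm n (Q : 'M[int]_n) r e i j : is_quiver Q ->
  e = 1 \/ e = -1 -> i != j -> `|companion Q r e i j| = `|Q i j|.
Proof.
move=> /matrixP Qs he ij; rewrite mxE (negPf ij).
have := Qs i j; rewrite !mxE => {}Qs.
case: eqP => [->|_]; first by case: he => ->; rewrite ?mul1r ?mulN1r ?normrN.
case: eqP => [jr|_]; last by lia.
by rewrite -jr Qs; case: he => ->; rewrite ?mul1r ?mulN1r !normrN.
Qed.

Lemma companion_sym n (Q : 'M[int]_n) r e : is_quiver Q ->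
  (companion Q r e)^T = companion Q r e.
Proof.
move=> /matrixP Qs; apply/matrixP => i j; rewrite !mxE eq_sym.
have [//|ij] := eqVneq i j.
have := Qs i j; rewrite !mxE => {}Qs.
have [jr|_] := eqVneq j r; have [ir|_] := eqVneq i r => //.
- by rewrite ir jr eqxx in ij.
- by rewrite Qs normrN.
Qed.

(** For [fs_trans]: arrows between out- and in-neighbours of [r] all run from out to in, and on
    either side an acyclic abundant quiver is a transitive tournament. *)
Lemma fork_state_init n (Q : 'M[int]_n) r e : is_fork Q r ->
  fork_state Q 1%:M (companion Q r e) (fun=> 1) r.
Proof.
move=> [[/matrixP Qs ab _] [ret acyc_in acyc_out]].
have skew i j : Q j i = - Q i j by have := Qs i j; rewrite !mxE.
have side i : i != r -> 0 < Q i r \/ 0 < Q r i.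
  by move=> /ab; rewrite /num_arrows (skew i r); lia.
have {ret} ret i j : 0 < Q i r -> 0 < Q r j -> Q i r < Q j i /\ Q r j < Q j i.
  by move=> hi hj; apply: ret; rewrite inE.
have triangle (S : {set 'I_n}) i j l : acyclic_on Q S ->
    i \in S -> j \in S -> l \in S -> 0 < Q i j -> 0 < Q j l -> 0 < Q i l.
  move=> acyc iS jS lS hij hjl.
  have il : i != l.
    by apply: contraTneq hjl => <-; have := skew i j; lia.
  have := ab _ _ il; rewrite /num_arrows => hil.
  have sub : {subset [:: i; j; l] <= S}.
    by move=> u; rewrite !inE => /or3P[] /eqP->.
  have := acyc [:: i; j; l] isT sub.
  by rewrite /= /arrow hij hjl /= andbT; have := skew i l; lia.
split=> //.
- move=> i j l ir jr lr hij hjl.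
  have [hi|hi] := side i ir; have [hl|hl] := side l lr;
    have [hj|hj] := side j jr.
  + by apply: (triangle _ i j l acyc_in); rewrite ?inE.
  + by have [] := ret _ _ hi hj; have := skew i j; lia.
  + by have [] := ret _ _ hj hl; have := skew j l; lia.
  + by have [] := ret _ _ hi hj; have := skew i j; lia.
  + by have [] := ret _ _ hl hi; lia.
  + by have [] := ret _ _ hl hi; lia.
  + by have [] := ret _ _ hj hl; have := skew j l; lia.
  + by apply: (triangle _ i j l acyc_out); rewrite ?inE.
- by left.
- by move=> i j; rewrite mul1r mxE; case: eqP.
- by move=> i; rewrite mxE eqxx.
- move=> i j ir jr ij.
  by rewrite mxE (negPf ij) (negPf ir) (negPf jr) !mul1r.
Qed.

(** The two Gram conditions ask for opposite signs of row [r]; the direction of the arrows between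
    [r] and [k] decides which one applies. *)
Lemma ready_init n (Q : 'M[int]_n) r k : k != r ->
  ready Q 1%:M (companion Q r (if Q r k < 0 then 1 else -1)) (fun=> 1) r k.
Proof.
move=> kr; split; rewrite !mul1r => h.
- move=> j jr; rewrite mxE eq_sym (negPf jr) eqxx ifF; first by ring.
  by lia.
- move=> j; rewrite !mul1r !mxE; case: eqP; case: eqP; lia.
- move=> j jr; rewrite mxE eq_sym (negPf jr) eqxx h; ring.
- by [].
Qed.

(** * From norm 2 to the quadratic equation *)

Lemma quadratic_form_sym n (A : 'M[int]_n) (x : 'I_n -> int) :
    A^T = A -> (forall i, A i i = 2) ->
  \sum_i \sum_j x i * A i j * x j =
  (\sum_i x i ^+ 2
   + \sum_(i < n) \sum_(j < n | (i < j)%N) A i j * x i * x j) * 2.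
Proof.
move=> /matrixP As A2.
have split_row i : \sum_j x i * A i j * x j = x i ^+ 2 * 2
    + \sum_(j < n | (i < j)%N) A i j * x i * x j
    + \sum_(j < n | (j < i)%N) A j i * x j * x i.
  rewrite (bigD1 i) //= A2 -addrA; congr (_ + _); first by ring.
  rewrite (bigID (fun j : 'I_n => (i < j)%N)) /=; congr (_ + _).
    apply: eq_big => [j|j _]; last by ring.
    by rewrite -val_eqE /=; case: ltngtP.
  apply: eq_big => [j|j _]; last by have := As i j; rewrite mxE => ->; ring.
  by rewrite -val_eqE /=; case: ltngtP.
rewrite (eq_bigr _ (fun i _ => split_row i)) !big_split /= -mulr_suml.
rewrite [X in _ + X](exchange_big_dep predT) //=; ring.
Qed.

Theorem theorem1p6 (n : nat) (Q : 'M[int]_n) (r : 'I_n) (w : seq 'I_n)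
    (hQ : is_fork Q r) (hw : fork_preserving r w) (k : 'I_n) :
  let x := fun i : 'I_n => c_vector Q w k 0 i in
  exists s : 'I_n -> 'I_n -> bool,
    \sum_(i < n) x i ^+ 2
    + \sum_(i < n) \sum_(j < n | (i < j)%N)
        (-1) ^+ s i j * num_arrows Q i j * x i * x j = 1.
Proof.
move=> x; have Qs : is_quiver Q by case: hQ => [[]].
have /andP[red kr] := hw.
(* For empty [w] either sign would do. *)
pose e : int := if ohead w is Some k then if Q r k < 0 then 1 else -1 else 1.
have he : e = 1 \/ e = -1.
  by rewrite /e; case: ohead => [l|]; [case: ifP|]; auto.
pose A := companion Q r e.
(* With this exponent, the signed number of arrows is [A i j] itself. *)
exists (fun i j => A i j < 0).
have As : A^T = A := companion_sym r e Qs.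
have A2 i : A i i = 2 by rewrite mxE eqxx.
have x2 : gram A (c_matrix Q w) k k = 2.
  apply: (gram_norm_mutate_seq _ As red kr); rewrite gram1.
    exact: fork_state_init.
  move=> l wl; rewrite /A /e wl; apply: ready_init.
  by apply: contraNneq kr => <-; rewrite wl.
move: x2; rewrite gramE.
have -> : \sum_i \sum_j c_matrix Q w k i * A i j * c_matrix Q w k j =
    \sum_i \sum_j x i * A i j * x j.
  by apply: eq_bigr => i _; apply: eq_bigr => j _; rewrite /x !mxE.
have half (u : int) : u * 2 = 2 -> u = 1 by lia.
rewrite quadratic_form_sym // => /half q1.
rewrite -[RHS]q1; congr (_ + _); apply: eq_bigr => i _; apply: eq_bigr => j ij.
congr (_ * _ * _); rewrite /num_arrows -(companion_norm r Qs he); last first.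
  by rewrite -val_eqE /= ltn_eqF.
rewrite -/A; case: ltrP => h; first by rewrite ltr0_norm // expr1 mulN1r opprK.
by rewrite ger0_norm // expr0 mul1r.
Qed.
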